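(* Let $\rho\in[0,\infty]$ and let $k$ be a $\rho$-viable kernel structure on $\mathbb{R}^{2m+1}$ (i.e. $\Theta_k^\rho\neq\varnothing$). Let $J:(0,\infty)\times\Phi_k\to\mathbb{R}$, $\iota\in(0,\infty)$, $\chi\in(0,1)$, and let $(\beta,\eta)$ be an optimal solution of $$\min_{\beta\in[\iota,\infty),\ \eta\in\Theta_k^\rho} J(\beta,\eta).$$ Let $f$ be the optimal solution of $$\min_{f\in\mathcal{H}(k_\eta)}\ \sum_{i=m+1}^n\big(f(\bar z_i)-\bar y_i\big)^2+\beta|f|_{k_\eta}^2\quad\text{subject to}\quad m|f|_{k_\eta}^2\le\chi .$$ Then $\Sigma(f)$ is BIBS stable. If, in addition, $f$ is continuous, then $\Sigma(f)$ has the wAG property with asymptotic bias $b(\rho)$, where $b(\cdot)$ is a class-$\mathcal{K}$ function (for $\rho=\infty$ this is read as: with some finite asymptotic bias). Finally, if $\rho=0$, then $\Sigma(f)$ is ISS.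
   Context: $|\cdot|$ is the Euclidean norm; $|x|_\infty=\sup_t|x_t|\in[0,\infty]$ for a sequence $x$ (finite or infinite); $x_{0:t}=(x_0,\dots,x_t)$; $\mathbb{N}$ contains $0$. A function $\gamma:[0,\infty)\to[0,\infty)$ is of class $\mathcal{K}$ if it is continuous, strictly increasing and $\gamma(0)=0$. A function $\alpha:[0,\infty)^2\to[0,\infty)$ is of class $\mathcal{KL}$ if $\alpha(\cdot,t)$ is of class $\mathcal{K}$ for each $t$, and for each $s$, $\alpha(s,\cdot)$ is continuous, decreasing and tends to $0$ at infinity. System. Let $m\in\mathbb{N}$, $m\ge1$. For $f:\mathbb{R}^{2m+1}\to\mathbb{R}$ (written $f(x,v)$ with $x\in\mathbb{R}^{2m}$, $v\in\mathbb{R}$), $\Sigma(f)$ is the discrete-time system $$x_{t+1}=Ax_t+Gf(x_t,v_t)+G\varepsilon_t+Hv_t,\quad t\in\mathbb{N},$$ with state $x_t\in\mathbb{R}^{2m}$ and inputs $v_t,\varepsilon_t\in\mathbb{R}$, where $A=\mathrm{diag}(S,S)$ (block diagonal), $G=\mathrm{col}(B,0_m)$, $H=\mathrm{col}(0_m,B)$ (vertical stacking), $S=\begin{bmatrix}0_{m-1}&I_{m-1}\\0&0_{m-1}^\top\end{bmatrix}\in\mathbb{R}^{m\times m}$, $B=\begin{bmatrix}0_{m-1}\\1\end{bmatrix}\in\mathbb{R}^m$. A solution is a triple of sequences $(x,v,\varepsilon)$ satisfying this recursion. Stability notions. - $\Sigma(f)$ is BIBS stable if for every $q\in[0,\infty)$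 there is $w\in[0,\infty)$ such that every solution with $|x_0|\le q$, $|v|_\infty\le q$, $|\varepsilon|_\infty\le q$ satisfies $|x|_\infty\le w$. - $\Sigma(f)$ is ISS if there exist $\alpha$ of class $\mathcal{KL}$ and $\kappa_u,\kappa_e$ of class $\mathcal{K}$ such that every solution satisfies $|x_t|\le\alpha(|x_0|,t)+\kappa_u(|v_{0:t}|_\infty)+\kappa_e(|\varepsilon_{0:t}|_\infty)$ for all $t\in\mathbb{N}$. - $\Sigma(f)$ has the wAG (weak asymptotic gain) property with asymptotic bias $b\in[0,\infty)$ if there is a class-$\mathcal{K}$ function $\kappa$ such that every solution satisfies $\limsup_{t\to\infty}|x_t|\le b+\kappa(\limsup_{t\to\infty}\max(|v_t|,|\varepsilon_t|))$ (the inequality being required when the limsup on the right is finite). Kernels. A kernel structure $k$ consists of a parameter set $\Phi_k\subseteq\mathbb{R}^{n_\eta}$ and, for each $\eta\in\Phi_k$, a symmetric positive semidefinite kernel $k_\eta:\mathbb{R}^{2m+1}\times\mathbb{R}^{2m+1}\to\mathbb{R}$. $\mathcal{H}(k_\eta)$ is the reproducing kernel Hilbert space (RKHS) of $k_\eta$, with norm $|\cdot|_{k_\eta}$. For $\rho\in[0,\infty]$, the $\rho$-viability set $\Theta_k^\rho$ is the set of $\eta\in\Phi_k$ for which there exist $\nu\in[0,\rho]\cap\mathbb{R}$ and $s\in[0,\infty)$ such that for all $a\in\mathbb{R}^{2m+1}$: $|a|^2\ge\nu\Rightarrow k_\eta(a,a)\le|a|^2$, and $|a|^2<\nu\Rightarrow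 k_\eta(a,a)\le s$. $k$ is $\rho$-viable if $\Theta_k^\rho\ne\varnothing$. Data. $n\in\mathbb{N}$, $n>m$, and a dataset of real numbers $(\bar u_i,\bar y_i)_{i=1}^n$ is given; for $t\in\{m+1,\dots,n\}$, $\bar z_t=(\bar y_{t-m},\dots,\bar y_{t-1},\bar u_{t-m},\dots,\bar u_t)\in\mathbb{R}^{2m+1}$. The function $J$ may depend on the dataset. *)

(* Defs.v *)
From HB Require Import structures.
From mathcomp Require Import all_boot all_order all_algebra.
From mathcomp Require Import all_classical all_reals all_analysis.

Set Implicit Arguments.
Unset Strict Implicit.
Unset Printing Implicit Defensive.

Import Order.TTheory GRing.Theory Num.Theory.
Import numFieldNormedType.Exports.

Local Open Scope classical_set_scope.
Local Open Scope ring_scope.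

(* The norm that mathcomp-analysis puts on matrices is the max-norm, hence a
   separate Euclidean norm.  (The topologies agree, so [continuous] is the
   usual notion on 'cV[R]_d.) *)
Definition enorm (R : realType) (d : nat) (x : 'cV[R]_d) : R :=
  Num.sqrt (\sum_(i < d) x i 0 ^+ 2).

Definition supnorm (R : realType) (u : nat -> R) : \bar R :=
  ereal_sup [set `|u t|%:E | t in [set: nat]].

(* sup-norm of the finite sequence (u_0, ..., u_t) *)
Definition supnorm_upto (R : realType) (u : nat -> R) (t : nat) : R :=
  \big[Num.max/0]_(i < t.+1) `|u i|.

(* Functions on [0, +oo[ are represented by total functions R -> R of which
   only the values on [0, +oo[ are constrained; nonnegativity of the values
   follows from monotonicity and g 0 = 0. *)
Definition classK (R : realType) (g : R -> R) : Prop :=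
  [/\ {within `[0, +oo[, continuous g},
      {in `[0, +oo[ &, {homo g : x y / x < y}}
    & g 0 = 0].

(* "Decreasing" in the second argument is necessarily non-strict, since
   alpha 0 t = 0 for every t. *)
Definition classKL (R : realType) (alpha : R -> R -> R) : Prop :=
  (forall t, 0 <= t -> classK (fun s => alpha s t)) /\
  (forall s, 0 <= s ->
    [/\ {within `[0, +oo[, continuous (alpha s)},
        {in `[0, +oo[ &, {homo alpha s : x y /~ x <= y}}
      & alpha s t @[t --> +oo] --> 0]).

Section System.
Variables (R : realType) (m : nat).

Definition shift_mx : 'M[R]_m := \matrix_(i, j) (j == i.+1 :> nat)%:R.

Definition last_col : 'cV[R]_m := \col_i (i.+1 == m :> nat)%:R.

Definition Amx : 'M[R]_(m + m) := block_mx shift_mx 0 0 shift_mx.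

Definition Gmx : 'cV[R]_(m + m) := col_mx last_col 0.

Definition Hmx : 'cV[R]_(m + m) := col_mx 0 last_col.

(* R^(2m+1) is 'cV_(m + m + 1), and f(x, v) is f (pair_xv x v). *)
Definition pair_xv (x : 'cV[R]_(m + m)) (v : R) : 'cV[R]_(m + m + 1) :=
  col_mx x (const_mx v).

Definition solution (f : 'cV[R]_(m + m + 1) -> R)
    (x : nat -> 'cV[R]_(m + m)) (v eps : nat -> R) : Prop :=
  forall t, x t.+1 = Amx *m x t + f (pair_xv (x t) (v t)) *: Gmx
                     + eps t *: Gmx + v t *: Hmx.

Definition BIBS (f : 'cV[R]_(m + m + 1) -> R) : Prop :=
  forall q : R, 0 <= q -> exists2 w : R, 0 <= w &
    forall x v eps, solution f x v eps ->
      enorm (x 0%N) <= q ->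
      (supnorm v <= q%:E)%E -> (supnorm eps <= q%:E)%E ->
      (supnorm (fun t => enorm (x t)) <= w%:E)%E.

Definition ISS (f : 'cV[R]_(m + m + 1) -> R) : Prop :=
  exists (alpha : R -> R -> R) (kappa_u kappa_e : R -> R),
    [/\ classKL alpha, classK kappa_u, classK kappa_e &
      forall x v eps, solution f x v eps -> forall t : nat,
        enorm (x t) <= alpha (enorm (x 0%N)) t%:R
                       + kappa_u (supnorm_upto v t)
                       + kappa_e (supnorm_upto eps t)].

Definition wAG (f : 'cV[R]_(m + m + 1) -> R) (b : R) : Prop :=
  exists2 kappa : R -> R, classK kappa &
    forall x v eps, solution f x v eps ->
      let L := limn_esup (fun t => (Num.max `|v t| `|eps t|)%:E) in
      L \is a fin_num ->
      (limn_esup (fun t => (enorm (x t))%:E) <= (b + kappa (fine L))%:E)%E.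

(* Regressor (y_(t-m), ..., y_(t-1), u_(t-m), ..., u_t), meant for m < t. *)
Definition regressor (u y : nat -> R) (t : nat) : 'cV[R]_(m + m + 1) :=
  pair_xv (col_mx (\col_(j < m) y (t - m + j)%N) (\col_(j < m) u (t - m + j)%N))
          (u t).

End System.

Definition psd_kernel (R : realType) (X : Type) (k : X -> X -> R) : Prop :=
  (forall a b, k a b = k b a) /\
  (forall (N : nat) (a : 'I_N -> X) (c : 'I_N -> R),
     0 <= \sum_(i < N) \sum_(j < N) c i * c j * k (a i) (a j)).

Record kernel_structure (R : realType) (d p : nat) := KernelStructure {
  kparams : set 'cV[R]_p;
  kfun : 'cV[R]_p -> 'cV[R]_d -> 'cV[R]_d -> R;
  kernel_psd : forall eta, kparams eta -> psd_kernel (kfun eta)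
}.

(* The RKHS of k: a Hilbert space of functions (a linear subspace [rk_set] of
   X -> R, with an inner product [rk_ip] whose values matter only on [rk_set])
   containing the sections of k and satisfying the reproducing property.  By
   the Moore-Aronszajn theorem it exists and is unique (as a set of functions
   with inner product) when k is symmetric positive semidefinite. *)
Record rkhs (R : realType) (X : Type) (k : X -> X -> R) := RKHS {
  rk_set : set (X -> R);
  rk_ip : (X -> R) -> (X -> R) -> R;
  rk_zero : rk_set (fun=> 0);
  rk_lin : forall (c : R) g h, rk_set g -> rk_set h ->
    rk_set (fun a => c * g a + h a);
  rk_ipC : forall g h, rk_set g -> rk_set h -> rk_ip g h = rk_ip h g;
  rk_ip_lin : forall (c : R) g1 g2 h, rk_set g1 -> rk_set g2 -> rk_set h ->
    rk_ip (fun a => c * g1 a + g2 a) h = c * rk_ip g1 h + rk_ip g2 h;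
  rk_ip_ge0 : forall g, rk_set g -> 0 <= rk_ip g g;
  rk_ip_eq0 : forall g, rk_set g -> rk_ip g g = 0 -> g = fun=> 0;
  rk_complete : forall g : nat -> X -> R, (forall i, rk_set (g i)) ->
    (forall e : R, 0 < e -> exists N : nat, forall i j, (N <= i)%N -> (N <= j)%N ->
       Num.sqrt (rk_ip (fun a => g i a - g j a) (fun a => g i a - g j a)) < e) ->
    exists2 h, rk_set h &
      forall e : R, 0 < e -> exists N : nat, forall i, (N <= i)%N ->
       Num.sqrt (rk_ip (fun a => g i a - h a) (fun a => g i a - h a)) < e;
  rk_section : forall a, rk_set (k a);
  rk_reproducing : forall g a, rk_set g -> rk_ip g (k a) = g a
}.

Definition rk_norm (R : realType) (X : Type) (k : X -> X -> R) (H : rkhs k)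
    (g : X -> R) : R :=
  Num.sqrt (rk_ip H g g).

Definition viability_set (R : realType) (d p : nat)
    (k : kernel_structure R d p) (rho : \bar R) : set 'cV[R]_p :=
  [set eta | kparams k eta /\
    exists nu s : R, [/\ 0 <= nu, (nu%:E <= rho)%E, 0 <= s &
      forall a : 'cV[R]_d,
        (nu <= enorm a ^+ 2 -> kfun k eta a a <= enorm a ^+ 2) /\
        (enorm a ^+ 2 < nu -> kfun k eta a a <= s)]].

Definition viable (R : realType) (d p : nat) (k : kernel_structure R d p)
    (rho : \bar R) : Prop :=
  viability_set k rho !=set0.

(* J is defined on ]0, +oo[ x kparams k in the mathematics; it is evaluated
   only there, provided 0 < iota. *)
Definition hyper_optimal (R : realType) (d p : nat)
    (k : kernel_structure R d p) (rho : \bar R) (J : R -> 'cV[R]_p -> R)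
    (iota beta : R) (eta : 'cV[R]_p) : Prop :=
  [/\ iota <= beta, viability_set k rho eta &
    forall beta' eta', iota <= beta' -> viability_set k rho eta' ->
      J beta eta <= J beta' eta'].

Section Regression.
Variables (R : realType) (m n : nat) (ubar ybar : nat -> R).
Variables (k : 'cV[R]_(m + m + 1) -> 'cV[R]_(m + m + 1) -> R) (H : rkhs k).

(* Only the entries 1, ..., n of the data sequences are used. *)
Definition regression_cost (beta : R) (g : 'cV[R]_(m + m + 1) -> R) : R :=
  \sum_(m.+1 <= i < n.+1) (g (regressor m ubar ybar i) - ybar i) ^+ 2
  + beta * rk_norm H g ^+ 2.

Definition regression_feasible (chi : R) (g : 'cV[R]_(m + m + 1) -> R) : Prop :=
  rk_set H g /\ m%:R * rk_norm H g ^+ 2 <= chi.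

Definition regression_optimal (beta chi : R)
    (f : 'cV[R]_(m + m + 1) -> R) : Prop :=
  regression_feasible chi f /\
  forall g, regression_feasible chi g ->
    regression_cost beta f <= regression_cost beta g.

End Regression.

(* Main.v *)
Require Import Defs.
From HB Require Import structures.
From mathcomp Require Import all_boot all_order all_algebra.
From mathcomp Require Import all_classical all_reals all_analysis.
From mathcomp Require Import ring lra.

Set Implicit Arguments.
Unset Strict Implicit.
Unset Printing Implicit Defensive.

Import Order.TTheory GRing.Theory Num.Theory.
Import numFieldNormedType.Exports.

Local Open Scope classical_set_scope.
Local Open Scope ring_scope.

(** By Cauchy-Schwarz in the RKHS, f(a)^2 <= c k(a,a) with c = |f|^2 and
    m c <= chi < 1, so viability gives f(a)^2 <= c |a|^2 + s for all a, with
    s = 0 when rho = 0.  The state consists of two shift registers p and q of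
    length m.  The weighted energy V = sum_i (i + 1) (p_i^2 + q_i^2) decreases
    along a shift by |x|^2, while inserting a new entry y costs m y^2; since
    m c < 1 this yields V(x_(t+1)) <= th V(x_t) + K (v_t^2 + eps_t^2 + s) with
    th < 1, and all three stability properties follow.

    The bias can be taken linear in rho.  If |f(a)|^2 <= c |a|^2 holds
    everywhere there is no bias.  Otherwise, by continuity, it fails at some
    a <> 0, and then eta can be viable only for rho > |a|^2 > 0, so that a
    single bias b0 is bounded by (b0 + 1) rho / |a|^2. *)

(** * Euclidean norms of stacked vectors *)

Lemma enorm_ge0 (R : realType) d (x : 'cV[R]_d) : 0 <= enorm x.
Proof. exact: sqrtr_ge0. Qed.

Lemma sqr_enorm (R : realType) d (x : 'cV[R]_d) :
  enorm x ^+ 2 = \sum_(i < d) x i 0 ^+ 2.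
Proof. by rewrite sqr_sqrtr // sumr_ge0 // => i _; exact: sqr_ge0. Qed.

Lemma sqr_enorm_col_mx (R : realType) d1 d2 (x : 'cV[R]_d1) (y : 'cV[R]_d2) :
  enorm (col_mx x y) ^+ 2 = enorm x ^+ 2 + enorm y ^+ 2.
Proof.
rewrite !sqr_enorm big_split_ord /=.
by congr (_ + _); apply: eq_bigr => i _; rewrite ?col_mxEu ?col_mxEd.
Qed.

Lemma sqr_enorm_vsubmx (R : realType) d1 d2 (x : 'cV[R]_(d1 + d2)) :
  enorm x ^+ 2 = enorm (usubmx x) ^+ 2 + enorm (dsubmx x) ^+ 2.
Proof. by rewrite -sqr_enorm_col_mx vsubmxK. Qed.

Lemma enorm_eq0 (R : realType) d (x : 'cV[R]_d) : enorm x = 0 -> x = 0.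
Proof.
move=> x0; apply/colP => i; rewrite mxE; apply/eqP; rewrite -sqrf_eq0.
have /eqP : \sum_(i < d) x i 0 ^+ 2 = 0 by rewrite -sqr_enorm x0 expr0n.
rewrite psumr_eq0 => [/allP/(_ i)|j _]; last exact: sqr_ge0.
by rewrite mem_index_enum => /(_ isT).
Qed.

(** The squared norm of [c * k a + f] is nonnegative for every real [c], and its minimum over [c]
    gives the inequality. When [k a a = 0] this quadratic degenerates to an affine function of [c],
    which forces [f a = 0]. *)
Lemma rkhs_Cauchy_Schwarz (R : realType) (X : Type) (k : X -> X -> R)
    (H : rkhs k) (f : X -> R) (a : X) : rk_set H f ->
  f a ^+ 2 <= rk_norm H f ^+ 2 * k a a.
Proof.
move=> Hf; have Hk := rk_section H a.
rewrite sqr_sqrtr ?rk_ip_ge0//.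
have kk : rk_ip H (k a) (k a) = k a a := rk_reproducing a Hk.
have fk : rk_ip H f (k a) = f a := rk_reproducing a Hf.
have K0 : 0 <= k a a by rewrite -kk rk_ip_ge0.
have ip_ge0 c : 0 <= c ^+ 2 * k a a + 2 * c * f a + rk_ip H f f.
  have Hg := rk_lin c Hk Hf.
  have := rk_ip_ge0 Hg; rewrite rk_ip_lin// (rk_ipC Hk Hg) (rk_ipC Hf Hg).
  rewrite !rk_ip_lin// kk fk (rk_ipC Hk Hf) fk => /le_trans; apply.
  by rewrite le_eqVlt; apply/orP; left; apply/eqP; ring.
have [K_eq0|K_neq0] := eqVneq (k a a) 0.
  rewrite K_eq0 mulr0; have [->|fa_neq0] := eqVneq (f a) 0.
    by rewrite expr0n.
  (* This [c] gives the affine function the value -1. *)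
  have := ip_ge0 (- (rk_ip H f f + 1) / (2 * f a)).
  rewrite K_eq0 mulr0 add0r.
  have -> : 2 * (- (rk_ip H f f + 1) / (2 * f a)) * f a = - (rk_ip H f f + 1).
    by field.
  lra.
have K_gt0 : 0 < k a a by rewrite lt_neqAle eq_sym K_neq0.
(* The minimiser of the quadratic. *)
have := ip_ge0 (- f a / k a a).
have -> : (- f a / k a a) ^+ 2 * k a a + 2 * (- f a / k a a) * f a
   + rk_ip H f f = rk_ip H f f - f a ^+ 2 / k a a by field.
by rewrite subr_ge0 ler_pdivrMr.
Qed.

(** * Weighted energy of the shift registers *)

Definition register_energy (R : realType) m (w : 'cV[R]_m) : R :=
  \sum_(i < m) i.+1%:R * w i 0 ^+ 2.

Lemma shift_mx_mulE (R : realType) m (w : 'cV[R]_m.+1) (i : 'I_m) :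
  (shift_mx R m.+1 *m w) (widen_ord (leqnSn m) i) 0 = w (lift ord0 i) 0.
Proof.
rewrite mxE (bigD1 (lift ord0 i)) //= mxE /= eqxx mul1r big1 ?addr0//.
move=> j ji; rewrite mxE; case: eqP => [/= E|]; last by rewrite mul0r.
by case/eqP: ji; exact: val_inj.
Qed.

Lemma shift_mx_mul_max (R : realType) m (w : 'cV[R]_m.+1) :
  (shift_mx R m.+1 *m w) ord_max 0 = 0.
Proof.
rewrite mxE big1 // => j _; rewrite mxE; case: eqP => [/= E|]; last first.
  by rewrite mul0r.
by have := ltn_ord j; rewrite E ltnn.
Qed.

(** The weight of an entry is the number of shifts after which it drops out. A shift lowers every
    weight by one, a total loss of [enorm w ^+ 2], and the inserted entry [u] starts with weight
    [m]. *)
Lemma register_energy_step (R : realType) m (w : 'cV[R]_m) (u : R) :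
  register_energy (shift_mx R m *m w + u *: last_col R m)
    = register_energy w - enorm w ^+ 2 + m%:R * u ^+ 2.
Proof.
rewrite sqr_enorm /register_energy -sumrB.
case: m w => [|m] w; first by rewrite !big_ord0 mul0r addr0.
(* The inserted entry is split off on the left, the departing one on the right; the latter has net
   weight 1 - 1 = 0. *)
rewrite big_ord_recr [in RHS]big_ord_recl /=; congr (_ + _); last first.
  by rewrite mxE shift_mx_mul_max 2!mxE /= eqxx mulr1 add0r.
rewrite mul1r subrr add0r; apply: eq_bigr => i _.
rewrite mxE shift_mx_mulE 2!mxE /= eqSS (ltn_eqF (ltn_ord i)) mulr0 addr0.
by rewrite /bump /= add1n -natr1; ring.
Qed.

Lemma enorm_le_register_energy (R : realType) m (w : 'cV[R]_m) :
  enorm w ^+ 2 <= register_energy w.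
Proof.
rewrite sqr_enorm; apply: ler_sum => i _.
by rewrite ler_peMl ?sqr_ge0 // ler1n.
Qed.

Lemma register_energy_le (R : realType) m (w : 'cV[R]_m) :
  register_energy w <= m%:R * enorm w ^+ 2.
Proof.
rewrite sqr_enorm mulr_sumr; apply: ler_sum => i _.
by rewrite ler_wpM2r ?sqr_ge0 // ler_nat.
Qed.

Definition state_energy (R : realType) m (x : 'cV[R]_(m + m)) : R :=
  register_energy (usubmx x) + register_energy (dsubmx x).

Lemma enorm_le_state_energy (R : realType) m (x : 'cV[R]_(m + m)) :
  enorm x ^+ 2 <= state_energy x.
Proof.
by rewrite sqr_enorm_vsubmx lerD// enorm_le_register_energy.
Qed.

Lemma state_energy_le (R : realType) m (x : 'cV[R]_(m + m)) :
  state_energy x <= m%:R * enorm x ^+ 2.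
Proof.
rewrite sqr_enorm_vsubmx mulrDr.
by rewrite lerD// register_energy_le.
Qed.

Lemma sqr_enorm_pair_xv (R : realType) m (x : 'cV[R]_(m + m)) v :
  enorm (pair_xv x v) ^+ 2 = enorm x ^+ 2 + v ^+ 2.
Proof. by rewrite sqr_enorm_col_mx !sqr_enorm big_ord1 mxE. Qed.

Lemma state_energy_step (R : realType) m (f : 'cV[R]_(m + m + 1) -> R)
    x v eps t : solution f x v eps ->
  state_energy (x t.+1) = state_energy (x t) - enorm (x t) ^+ 2
    + m%:R * (f (pair_xv (x t) (v t)) + eps t) ^+ 2 + m%:R * v t ^+ 2.
Proof.
move=> sol; rewrite (sol t); set p := f _.
rewrite /Amx /Gmx /Hmx -[X in _ *m X + _]vsubmxK mul_block_col !mul0mx addr0.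
rewrite add0r !scale_col_mx !add_col_mx !scaler0 !addr0 -addrA -scalerDl.
rewrite /state_energy col_mxKu col_mxKd !register_energy_step.
rewrite (sqr_enorm_vsubmx (x t)); ring.
Qed.

(** * One-step contraction of the energy *)

Definition quadratic_growth (R : realType) d (f : 'cV[R]_d -> R) (c s : R) :=
  forall a, f a ^+ 2 <= c * enorm a ^+ 2 + s.

(* Peter-Paul with weight [del] on the noise: [del] is chosen so that
   [(1 + del) * chi < 1]. *)
Lemma state_energy_contraction (R : realType) m (c chi s : R) :
  (1 <= m)%N -> 0 < chi -> chi < 1 -> 0 <= s -> 0 <= c -> m%:R * c <= chi ->
  exists th K : R, [/\ 0 <= th, th < 1, 0 < K &
    forall f : 'cV[R]_(m + m + 1) -> R, quadratic_growth f c s ->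
    forall x v eps, solution f x v eps -> forall t,
      state_energy (x t.+1)
        <= th * state_energy (x t) + K * (v t ^+ 2 + eps t ^+ 2 + s)].
Proof.
move=> m1 chi0 chi1 s0 c0 mc.
have m_ge1 : 1 <= m%:R :> R by rewrite ler1n.
have m_gt0 : 0 < m%:R :> R by rewrite ltr0n.
have [del del0 lam1] : exists2 del, 0 < del & (1 + del) * chi < 1.
  (* Here [1 - (1 + del) * chi = (1 - chi) * (1 - chi / 2)]. *)
  by exists ((1 - chi) / 2); nra.
have : 0 <= (1 + del) * chi by rewrite mulr_ge0//; lra.
move: lam1; set lam := (1 + del) * chi => lam1 lam0.
have lamE : lam = (1 + del) * chi by [].
clearbody lam.
have div_le1 : (1 - lam) / m%:R <= 1 by rewrite ler_pdivrMr //; lra.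
have div_gt0 : 0 < (1 - lam) / m%:R by rewrite divr_gt0//; lra.
have di : 0 < del^-1 by rewrite invr_gt0.
(* [K] dominates the coefficients of [v t ^+ 2], [eps t ^+ 2] and [s] alike. *)
pose K := m%:R * (2 + del + del^-1).
have mdel := mulr_gt0 m_gt0 del0; have mdi := mulr_gt0 m_gt0 di.
have lamK : lam + m%:R <= K by rewrite /K !mulrDr; lra.
have epsK : m%:R * (1 + del^-1) <= K by rewrite /K !mulrDr; lra.
have sK : m%:R * (1 + del) <= K by rewrite /K !mulrDr; lra.
(* The net decrease is [(1 - lam) * enorm (x t) ^+ 2]; since the energy is at most [m] times the
   squared norm, this is at least the fraction [(1 - lam) / m] of the energy. *)
exists (1 - (1 - lam) / m%:R), K; split; [lra|lra|lra|].
move=> f fgrowth x v eps sol t; rewrite (state_energy_step t sol).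
have fg := fgrowth (pair_xv (x t) (v t)).
rewrite sqr_enorm_pair_xv in fg.
have fV := state_energy_le (x t).
set p := f _ in fg *; set V := state_energy _ in fV *.
set X := enorm _ ^+ 2 in fg fV *.
have X0 : 0 <= X by exact: sqr_ge0.
have v0 : 0 <= v t ^+ 2 by exact: sqr_ge0.
have e0 : 0 <= eps t ^+ 2 by exact: sqr_ge0.
have young : (p + eps t) ^+ 2 <= (1 + del) * p ^+ 2 + (1 + del^-1) * eps t ^+ 2.
  rewrite -subr_ge0; have -> : (1 + del) * p ^+ 2 + (1 + del^-1) * eps t ^+ 2 -
    (p + eps t) ^+ 2 = del^-1 * (del * p - eps t) ^+ 2.
    by field; rewrite gt_eqF.
  by rewrite mulr_ge0 ?sqr_ge0 // ltW.
have mp : m%:R * p ^+ 2 <= chi * (X + v t ^+ 2) + m%:R * s.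
  have : m%:R * p ^+ 2 <= m%:R * (c * (X + v t ^+ 2) + s).
    by rewrite ler_pM2l.
  have : m%:R * c * (X + v t ^+ 2) <= chi * (X + v t ^+ 2).
    by rewrite ler_wpM2r // addr_ge0.
  lra.
have my : m%:R * (p + eps t) ^+ 2 <= lam * (X + v t ^+ 2)
    + m%:R * (1 + del) * s + m%:R * (1 + del^-1) * eps t ^+ 2.
  have : m%:R * (p + eps t) ^+ 2
      <= (1 + del) * (m%:R * p ^+ 2) + m%:R * (1 + del^-1) * eps t ^+ 2.
    have := ler_wpM2l (ltW m_gt0) young; move/le_trans; apply.
    by rewrite le_eqVlt; apply/orP; left; apply/eqP; ring.
  have : (1 + del) * (m%:R * p ^+ 2)
      <= (1 + del) * (chi * (X + v t ^+ 2) + m%:R * s).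
    by rewrite ler_wpM2l //; lra.
  have -> : (1 + del) * (chi * (X + v t ^+ 2) + m%:R * s) =
     lam * (X + v t ^+ 2) + m%:R * (1 + del) * s by rewrite lamE; ring.
  lra.
have VX : (1 - lam) / m%:R * V <= (1 - lam) * X.
  by rewrite mulrAC -mulrA ler_wpM2l ?subr_ge0 ?(ltW lam1)// ler_pdivrMr // mulrC.
have := ler_wpM2r v0 lamK; have := ler_wpM2r e0 epsK.
have := ler_wpM2r s0 sK.
lra.
Qed.

(** * Bounds along whole trajectories *)

Lemma affine_recursion (R : realType) (V : nat -> R) (th B : R) n :
  0 <= th -> th < 1 -> 0 <= B ->
  (forall i, (i < n)%N -> V i.+1 <= th * V i + B) ->
  V n <= th ^+ n * V 0%N + B / (1 - th).
Proof.
move=> th0 th1 B0; elim: n => [|n IHn] Vstep.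
  by rewrite expr0 mul1r lerDl divr_ge0 // subr_ge0 ltW.
have Vn := IHn (fun i lt_in => Vstep i (ltnW lt_in)).
apply: (le_trans (Vstep n (ltnSn n))).
(* [B / (1 - th)] is the fixed point of [r |-> th * r + B]. *)
have -> : th ^+ n.+1 * V 0%N + B / (1 - th)
    = th * (th ^+ n * V 0%N + B / (1 - th)) + B.
  by rewrite exprS; field; rewrite subr_eq0 gt_eqF.
by rewrite lerD2r ler_wpM2l.
Qed.

(** Only the inputs before time [n] are constrained, so the bound serves finite horizons (ISS) and
    trajectories restarted at a later time (wAG) as well as bounded inputs. *)
Definition quadratic_gain (R : realType) m (f : 'cV[R]_(m + m + 1) -> R)
    (s th K : R) :=
  forall x v eps, solution f x v eps -> forall (n : nat) (B : R),
    (forall i, (i < n)%N -> v i ^+ 2 + eps i ^+ 2 <= B) ->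
    0 <= B ->
    enorm (x n) ^+ 2 <= m%:R * th ^+ n * enorm (x 0%N) ^+ 2 + K * (B + s).

(** The energy lies between [enorm ^+ 2] and [m * enorm ^+ 2], whence the factor [m] on the
    transient; summing the geometric series divides [K] by [1 - th]. *)
Lemma growth_quadratic_gain (R : realType) m (c chi s : R)
    (f : 'cV[R]_(m + m + 1) -> R) :
  (1 <= m)%N -> 0 < chi -> chi < 1 -> 0 <= s -> 0 <= c -> m%:R * c <= chi ->
  quadratic_growth f c s ->
  exists th K : R, [/\ 0 <= th, th < 1, 0 < K & quadratic_gain f s th K].
Proof.
move=> m1 chi0 chi1 s0 c0 mc fg.
have [th [K [th0 th1 K0 step]]] := state_energy_contraction m1 chi0 chi1 s0 c0 mc.
exists th, (K / (1 - th)); split => //.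
  by rewrite divr_gt0 // subr_gt0.
move=> x v eps sol n B vB B0.
apply: (le_trans (enorm_le_state_energy _)).
have KB0 : 0 <= K * (B + s) by rewrite mulr_ge0 ?addr_ge0 // ltW.
have V0 : m%:R * th ^+ n * enorm (x 0%N) ^+ 2 >= th ^+ n * state_energy (x 0%N).
  rewrite [_ * th ^+ n]mulrC -mulrA ler_wpM2l ?exprn_ge0 //.
  exact: state_energy_le.
rewrite [K / _ * _]mulrAC; apply: (le_trans _ (lerD V0 (lexx _))).
apply: (affine_recursion (V := fun i => state_energy (x i))) => // i lt_in.
apply: (le_trans (step f fg x v eps sol i)).
by rewrite lerD2l ler_wpM2l ?(ltW K0)// lerD2r vB.
Qed.

(** * The three stability properties *)

Lemma quadratic_gain_BIBS (R : realType) m (f : 'cV[R]_(m + m + 1) -> R) s th K :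
  0 <= th -> th < 1 -> 0 < K -> 0 <= s -> quadratic_gain f s th K -> BIBS f.
Proof.
move=> th0 th1 K0 s0 gain q q0.
exists (Num.sqrt (m%:R * q ^+ 2 + K * (2 * q ^+ 2 + s))); first exact: sqrtr_ge0.
move=> x v eps sol x0q vq epsq; apply: ge_ereal_sup => _ [t _ <-].
rewrite lee_fin ger0_norm ?enorm_ge0 // -[leLHS](ger0_norm (enorm_ge0 _)).
rewrite -sqrtr_sqr ler_wsqrtr //.
have leq (u : nat -> R) : (supnorm u <= q%:E)%E -> forall i, u i ^+ 2 <= q ^+ 2.
  move=> uq i; rewrite -[u i ^+ 2]real_normK ?num_real // ler_pXn2r ?nnegrE //.
  by rewrite -lee_fin (le_trans _ uq)//; apply: ereal_sup_ubound; exists i.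
have B0 : 0 <= 2 * q ^+ 2 by rewrite mulr_ge0 ?sqr_ge0.
apply: (le_trans (gain x v eps sol t _ _ B0)) => [i _|].
  by rewrite [2 * _]mulr_natl mulr2n lerD // leq.
rewrite lerD2r -mulrA ler_wpM2l //.
have qq : enorm (x 0%N) ^+ 2 <= q ^+ 2 by rewrite ler_pXn2r ?nnegrE ?enorm_ge0.
apply: le_trans qq.
by rewrite ler_piMl ?sqr_ge0 // exprn_ile1 // ltW.
Qed.

Lemma linear_classK (R : realType) (c : R) : 0 < c -> classK (fun r => c * r).
Proof.
move=> c0; split; last by rewrite mulr0.
  by apply: continuous_subspaceT => x; apply: cvgMl_tmp; exact: cvg_id.
by move=> x y _ _ xy; rewrite ltr_pM2l.
Qed.

Lemma exponential_classKL (R : realType) (c h : R) : 0 < c -> 0 < h ->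
  classKL (fun r t => c * r * expR (- (h * t))).
Proof.
move=> c0 h0; split=> [t t0|r r0].
  have -> : (fun r => c * r * expR (- (h * t))) = (fun r => c * expR (- (h * t)) * r).
    by apply/funext => r; rewrite mulrAC.
  by apply: linear_classK; rewrite mulr_gt0 ?expR_gt0.
split.
- apply: continuous_subspaceT => t; apply: cvgMl_tmp.
  apply: continuous_comp; last exact: continuous_expR.
  by apply: cvgN; apply: cvgMl_tmp; exact: cvg_id.
- move=> t u _ _ ut; rewrite ler_wpM2l ?mulr_ge0 ?(ltW c0)//.
  by rewrite ler_expR lerN2 ler_pM2l.
- rewrite -[X in _ --> X](mulr0 (c * r)); apply: cvgMl_tmp.
  have : expR (- t) @[t --> +oo] --> (0 : R) by exact: cvgr_expR.
  by apply: cvg_comp; exact: gt0_cvgMry.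
Qed.

Lemma le_supnorm_upto (R : realType) (u : nat -> R) (i t : nat) :
  (i <= t)%N -> `|u i| <= supnorm_upto u t.
Proof.
rewrite -ltnS => it.
exact: (le_bigmax 0 (fun j : 'I_t.+1 => `|u j|) (Ordinal it)).
Qed.

(** Since [th <= expR (th - 1)], also when [th = 0], the geometric transient is below an exponential
    in real time. Taking square roots halves its rate. *)
Lemma quadratic_gain_ISS (R : realType) m (f : 'cV[R]_(m + m + 1) -> R) th K :
  (1 <= m)%N -> 0 <= th -> th < 1 -> 0 < K -> quadratic_gain f 0 th K -> ISS f.
Proof.
move=> m1 th0 th1 K0 gain.
have sK : 0 < Num.sqrt K by rewrite sqrtr_gt0.
have sm : 0 < Num.sqrt m%:R :> R by rewrite sqrtr_gt0 ltr0n.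
have h0 : 0 < (1 - th) / 2 by rewrite divr_gt0 // subr_gt0.
exists (fun r t => Num.sqrt m%:R * r * expR (- ((1 - th) / 2 * t))).
exists (fun r => Num.sqrt K * r), (fun r => Num.sqrt K * r).
split; [exact: exponential_classKL|exact: linear_classK..|].
move=> x v eps sol t.
have V0 : 0 <= supnorm_upto v t by rewrite (le_trans _ (le_supnorm_upto v (leqnn t))).
have E0 : 0 <= supnorm_upto eps t.
  by rewrite (le_trans _ (le_supnorm_upto eps (leqnn t))).
set V := supnorm_upto v t in V0 *; set E := supnorm_upto eps t in E0 *.
have B0 : 0 <= V ^+ 2 + E ^+ 2 by rewrite addr_ge0 ?sqr_ge0.
set a := Num.sqrt m%:R * _ * _.
have a0 : 0 <= a by rewrite !mulr_ge0 ?sqrtr_ge0 ?expR_ge0 ?enorm_ge0.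
have a2 : m%:R * th ^+ t * enorm (x 0%N) ^+ 2 <= a ^+ 2.
  rewrite /a !exprMn (sqr_sqrtr (ler0n R m)) mulrAC.
  rewrite ler_wpM2r ?sqr_ge0 // ler_wpM2l //.
  have -> : expR (- ((1 - th) / 2 * t%:R)) ^+ 2 = expR (th - 1) ^+ t.
    by rewrite -!expRM_natl; congr expR; field.
  rewrite lerXn2r ?nnegrE ?expR_ge0 //.
  by have := expR_ge1Dx (th - 1); rewrite addrC subrK.
have kV0 := mulr_ge0 (ltW sK) V0; have kE0 := mulr_ge0 (ltW sK) E0.
rewrite -(@ler_pXn2r _ 2) ?nnegrE ?enorm_ge0 ?(addr_ge0 (addr_ge0 a0 kV0) kE0)//.
apply: (le_trans (gain x v eps sol t _ _ B0)) => [i lt_it|].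
  rewrite -[v i ^+ 2]real_normK ?num_real // -[eps i ^+ 2]real_normK ?num_real //.
  by rewrite lerD // ler_pXn2r ?nnegrE // le_supnorm_upto // ltnW.
have KE : K = Num.sqrt K ^+ 2 by rewrite sqr_sqrtr // ltW.
rewrite addr0 [in K * _]KE.
(* With nonnegative cross products, the sum of the three squares is at most the square of the
   sum. *)
have := mulr_ge0 a0 kV0; have := mulr_ge0 a0 kE0; have := mulr_ge0 kV0 kE0.
move: a2; set X := _ * enorm _ ^+ 2; set k := Num.sqrt K; clearbody X a k.
lra.
Qed.

Lemma limn_esup_lt_near (R : realType) (u : nat -> \bar R) l :
  (limn_esup u < l)%E -> \forall n \near \oo, (u n < l)%E.
Proof.
case/ereal_inf_lt => _ [V ooV <-] supl; apply: filterS ooV => n Vn.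
by apply: le_lt_trans supl; apply: ereal_sup_ubound; exists n.
Qed.

Lemma limn_esup_le_near (R : realType) (u : nat -> \bar R) l :
  (\forall n \near \oo, (u n <= l)%E) -> (limn_esup u <= l)%E.
Proof.
move=> ul; apply: ge_ereal_inf; eexists; first by exists [set n | (u n <= l)%E].
by apply: ge_ereal_sup => _ [n /= un <-].
Qed.

(** The trajectory is restarted at a time [N] after which both inputs stay below [l + e]. The
    transient from [x N] dies out, and [e] is arbitrary. The 2 in [k] comes from adding the squares
    of two inputs. *)
Lemma quadratic_gain_wAG (R : realType) m (f : 'cV[R]_(m + m + 1) -> R) s th K :
  0 <= th -> th < 1 -> 0 < K -> 0 <= s -> quadratic_gain f s th K ->
  wAG f (Num.sqrt (K * s)).
Proof.
move=> th0 th1 K0 s0 gain; set b := Num.sqrt (K * s); set k := Num.sqrt (2 * K).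
have b0 : 0 <= b by exact: sqrtr_ge0.
have k0 : 0 < k by rewrite sqrtr_gt0 mulr_gt0.
have bE : b ^+ 2 = K * s by rewrite sqr_sqrtr // mulr_ge0 // ltW.
have kE : k ^+ 2 = 2 * K by rewrite sqr_sqrtr // mulr_ge0 // ltW.
exists (fun r => k * r); first exact: linear_classK.
move=> x v eps sol L Lfin.
have {Lfin} : L = (fine L)%:E by rewrite fineK.
move: (fine L) => l Ll.
suff bound e : 0 < e ->
    (limn_esup (fun t => (enorm (x t))%:E) <= (b + k * (l + e) + e)%:E)%E.
  apply/lee_addgt0Pr => e e0.
  have k1 : 0 < k + 1 by rewrite addr_gt0.
  (* The margin [e / (k + 1)] enters once directly and once multiplied by [k], for a total of
     [e]. *)
  apply: (le_trans (bound _ (divr_gt0 e0 k1))).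
  rewrite -EFinD lee_fin.
  have -> : b + k * (l + e / (k + 1)) + e / (k + 1) = b + k * l + e.
    by field; rewrite gt_eqF.
  exact: lexx.
move=> e0; apply: limn_esup_le_near.
have /limn_esup_lt_near [N _ inputN] : (L < (l + e)%:E)%E.
  by rewrite Ll lte_fin ltrDl.
have input i : (N <= i)%N -> `|v i| < l + e /\ `|eps i| < l + e.
  by move=> /inputN /=; rewrite lte_fin gt_max => /andP.
(* The sign comes from [l + e] exceeding an absolute value. *)
have le0 : 0 < l + e by have [/(le_lt_trans (normr_ge0 _))] := input N (leqnn N).
have solN : solution f (fun i => x (N + i)%N) (fun i => v (N + i)%N)
    (fun i => eps (N + i)%N) by move=> i; rewrite addnS; exact: sol.
have B0 : 0 <= 2 * (l + e) ^+ 2 by rewrite mulr_ge0 ?sqr_ge0.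
have transient : \forall n \near \oo, m%:R * th ^+ n * enorm (x N) ^+ 2 < e ^+ 2.
  have : m%:R * th ^+ n * enorm (x N) ^+ 2 @[n --> \oo] --> (0 : R).
    rewrite -[X in _ --> X](mul0r (enorm (x N) ^+ 2)); apply: cvgMr_tmp.
    rewrite -[X in _ --> X](mulr0 m%:R); apply: cvgMl_tmp.
    by apply: cvg_expr; rewrite ger0_norm.
  by move/cvgr_lt; apply; rewrite exprn_gt0.
have [M _ transientM] := transient.
exists (N + M)%N => // n /= NMn; rewrite lee_fin.
have Nn : (N <= n)%N := leq_trans (leq_addr M N) NMn.
have := gain _ _ _ solN (n - N)%N _ _ B0; rewrite /= subnKC // addn0 => gainN.
have kle0 := mulr_gt0 k0 le0.
have sum0 := addr_ge0 (addr_ge0 b0 (ltW kle0)) (ltW e0).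
rewrite -(@ler_pXn2r _ 2) ?nnegrE ?enorm_ge0 //.
apply: (le_trans (gainN _)) => [i _|].
  have [vi ei] := input (N + i)%N (leq_addr _ _).
  rewrite [2 * _]mulr_natl mulr2n lerD //.
    by rewrite -[v _ ^+ 2]real_normK ?num_real // lerXn2r ?nnegrE ?(ltW le0) ?(ltW vi).
  by rewrite -[eps _ ^+ 2]real_normK ?num_real // lerXn2r ?nnegrE ?(ltW le0) ?(ltW ei).
have := transientM (n - N)%N; rewrite /= leq_subRL // => /(_ NMn).
rewrite [K * _]mulrDr -bE [K * (_ * _)]mulrA [K * 2]mulrC -kE -exprMn.
have := mulr_ge0 b0 (ltW kle0); have := mulr_ge0 b0 (ltW e0).
have := mulr_ge0 (ltW kle0) (ltW e0).
set X := _ * enorm _ ^+ 2; set y := k * (l + e); clearbody X b y.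
lra.
Qed.

(** * Growth bounds from viability, and the choice of the bias *)

Lemma wAG_le (R : realType) m (f : 'cV[R]_(m + m + 1) -> R) (b b' : R) :
  b <= b' -> wAG f b -> wAG f b'.
Proof.
move=> bb' [kappa Kkappa gain]; exists kappa => // x v eps sol L Lfin.
by apply: (le_trans (gain x v eps sol Lfin)); rewrite lee_fin lerD2r.
Qed.

(** The bound without offset outside the ball is kept separately: it holds everywhere once
    [nu <= 0], and any point violating it bounds [nu], hence [rho], from below. *)
Lemma viable_growth (R : realType) d p (k : kernel_structure R d p) rho eta
    (H : rkhs (kfun k eta)) f : rk_set H f -> viability_set k rho eta ->
  exists nu s : R, [/\ (nu%:E <= rho)%E, 0 <= s,
    quadratic_growth f (rk_norm H f ^+ 2) s &
    forall a, nu <= enorm a ^+ 2 -> f a ^+ 2 <= rk_norm H f ^+ 2 * enorm a ^+ 2].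
Proof.
move=> Hf [_ [nu [s [_ nu_rho s0 kle]]]].
have c0 : 0 <= rk_norm H f ^+ 2 by exact: sqr_ge0.
have outer a : nu <= enorm a ^+ 2 -> f a ^+ 2 <= rk_norm H f ^+ 2 * enorm a ^+ 2.
  move=> nu_a; apply: le_trans (rkhs_Cauchy_Schwarz a Hf) _.
  by rewrite ler_wpM2l // (kle a).1.
exists nu, (rk_norm H f ^+ 2 * s); split => // [|a]; first exact: mulr_ge0.
have [nu_a|a_nu] := leP nu (enorm a ^+ 2).
  by apply: le_trans (outer a nu_a) _; rewrite lerDl mulr_ge0.
apply: le_trans (rkhs_Cauchy_Schwarz a Hf) _.
apply: (@le_trans _ _ (rk_norm H f ^+ 2 * s)).
  by rewrite ler_wpM2l // (kle a).2.
by rewrite lerDr mulr_ge0 ?sqr_ge0.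
Qed.

(** Only the origin is at stake; there the inequality is the limit of those at the nonzero vectors
    [t *: e] as [t] tends to 0. *)
Lemma continuous_growth (R : realType) d (f : 'cV[R]_d -> R) (c : R) :
  (0 < d)%N -> continuous f ->
  (forall a, a != 0 -> f a ^+ 2 <= c * enorm a ^+ 2) -> quadratic_growth f c 0.
Proof.
case: d f => // d f _ fcont fle a; rewrite addr0.
have [->|/fle//] := eqVneq a 0.
pose e : 'cV[R]_d.+1 := const_mx 1.
have enorm_scale t : enorm (t *: e) ^+ 2 = t ^+ 2 * enorm e ^+ 2.
  by rewrite !sqr_enorm mulr_sumr; apply: eq_bigr => i _; rewrite mxE exprMn.
have -> : enorm (0 : 'cV[R]_d.+1) ^+ 2 = 0.
  by rewrite -(scale0r e) enorm_scale expr0n mul0r.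
rewrite mulr0.
have cvg_t : t *: e @[t --> (0 : R)^'] --> (0 : 'cV[R]_d.+1).
  rewrite -(scale0r e); apply: cvg_within_filter; exact: scalel_continuous.
have cvg_f : f (t *: e) ^+ 2 @[t --> (0 : R)^'] --> f 0 ^+ 2.
  rewrite expr2; under eq_fun do rewrite expr2.
  by apply: cvgM; apply: (cvg_comp _ _ cvg_t); exact: fcont.
have cvg_c : c * (t ^+ 2 * enorm e ^+ 2) @[t --> (0 : R)^'] --> (0 : R).
  rewrite -[X in _ --> X](mulr0 c) -[X in _ --> c * X](mul0r (enorm e ^+ 2)).
  apply: cvgMl_tmp; apply: cvgMr_tmp; apply: cvg_within_filter.
  by have := @exprn_continuous R 2 0; rewrite /continuous_at expr0n.
apply: (ler_cvg_to cvg_f cvg_c).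
near=> t; rewrite -enorm_scale; apply: fle.
have : t != 0 by near: t; exact: nbhs_dnbhs_neq.
apply: contra => /eqP/colP/(_ ord0); rewrite !mxE mulr1 => ->.
by [].
Unshelve. all: by end_near.
Qed.

Theorem theorem3 (R : realType) (m n p : nat) (m_ge1 : (1 <= m)%N)
    (n_gt_m : (m < n)%N) (ubar ybar : nat -> R)
    (k : kernel_structure R (m + m + 1) p)
    (J : R -> 'cV[R]_p -> R) (iota chi : R) (iota_gt0 : 0 < iota)
    (chi_gt0 : 0 < chi) (chi_lt1 : chi < 1)
    (beta : R) (eta : 'cV[R]_p) (H : rkhs (kfun k eta))
    (f : 'cV[R]_(m + m + 1) -> R)
    (f_opt : regression_optimal n ubar ybar H beta chi f) :
  exists2 b : R -> R, classK b &
    forall rho : \bar R, (0 <= rho)%E -> viable k rho ->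
      hyper_optimal k rho J iota beta eta ->
      [/\ BIBS f,
          continuous f ->
            (forall r : R, rho = r%:E -> wAG f (b r)) /\
            (rho = +oo%E -> exists2 c : R, 0 <= c & wAG f c)
        & rho = 0%E -> ISS f].
Proof.
have [[Hf mc] _] := f_opt.
have c_ge0 : 0 <= rk_norm H f ^+ 2 by exact: sqr_ge0.
have gain s : 0 <= s -> quadratic_growth f (rk_norm H f ^+ 2) s ->
    exists th K, [/\ 0 <= th, th < 1, 0 < K & quadratic_gain f s th K].
  by move=> s0; exact: (growth_quadratic_gain m_ge1 chi_gt0 chi_lt1 s0 c_ge0 mc).
have bias rho : viability_set k rho eta -> exists2 b, 0 <= b & wAG f b.
  move=> /(viable_growth Hf)[nu [s [_ s0 /(gain s s0)[th [K [th0 th1 K0 fK]]] _]]].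
  by exists (Num.sqrt (K * s)); [exact: sqrtr_ge0|exact: quadratic_gain_wAG fK].
(* The slope must not depend on [rho], so the cases below are distinguished by [f] alone. *)
have [D D0 wAG_D] : exists2 D : R, 0 < D & forall r : R, 0 <= r ->
    viability_set k r%:E eta -> continuous f -> wAG f (D * r).
  have [fle|nfle] := pselect (quadratic_growth f (rk_norm H f ^+ 2) 0).
    exists 1 => // r r0 _ _; rewrite mul1r; apply: wAG_le r0 _.
    have [th [K [th0 th1 K0 fK]]] := gain 0 (lexx 0) fle.
    by rewrite -sqrtr0 -(mulr0 K); exact: quadratic_gain_wAG fK.
  have [[a [a0 fa]]|nfa] := pselect (exists a, a != 0 /\
      rk_norm H f ^+ 2 * enorm a ^+ 2 < f a ^+ 2); last first.
    exists 1 => // r r0 _ fcont; exfalso; apply: nfle.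
    apply: continuous_growth fcont _; first by rewrite addn1.
    by move=> a a0; rewrite leNgt; apply/negP => fa; apply: nfa; exists a.
  have a2 : 0 < enorm a ^+ 2.
    rewrite exprn_gt0 // lt_neqAle enorm_ge0 eq_sym andbT.
    by apply: contra a0 => /eqP/enorm_eq0/eqP.
  (* If no bias works at all, [bias] shows that [eta] is viable for no radius, and any slope will
     do. *)
  have [[b0 b0_ge0 fb0]|nb0] := pselect (exists2 b, 0 <= b & wAG f b); last first.
    by exists 1 => // r r0 /bias.
  (* For [r >= enorm a ^+ 2] the bias is at least [b0 + 1]; the added 1 keeps the slope positive
     when [b0 = 0]. *)
  exists ((b0 + 1) / enorm a ^+ 2) => [|r r0 /(viable_growth Hf) viab _].
    by rewrite divr_gt0 // ltr_wpDl.
  have [nu [s [nur _ _ outer]]] := viab.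
  apply: wAG_le fb0; rewrite mulrAC ler_pdivlMr //.
  (* The point [a] violates the outer bound, so it lies inside the ball:
     [enorm a ^+ 2 < nu <= r]. *)
  have ar : enorm a ^+ 2 <= r.
    rewrite lee_fin in nur; apply: le_trans nur.
    by rewrite ltW // ltNge; apply/negP => /outer; rewrite leNgt fa.
  nra.
exists (fun r => D * r); first exact: linear_classK.
move=> rho rho0 _ [_ viab _].
have [nu [s [nu_rho s0 fgrowth outer]]] := viable_growth Hf viab.
split.
- have [th [K [th0 th1 K0 fK]]] := gain s s0 fgrowth.
  exact: quadratic_gain_BIBS fK.
- move=> fcont; split=> [r rhoE|_]; last exact: bias viab.
  by rewrite rhoE in rho0 viab; exact: wAG_D.
- move=> rhoE; rewrite rhoE lee_fin in nu_rho.
  (* Now [nu <= 0], so the outer bound covers every point and the offset is 0. *)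
  have [|th [K [th0 th1 K0 fK]]] := gain 0 (lexx 0).
    by move=> a; rewrite addr0 outer // (le_trans nu_rho) ?sqr_ge0.
  exact: quadratic_gain_ISS fK.
Qed.
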